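(* Let $u:\mathbb R\to\mathbb R$ be a solution, not identically zero, of the Painlevé II equation $u''(x)=x\,u(x)+2u^3(x)$ satisfying $u(x)\to 0$ and $u'(x)\to 0$ as $x\to\infty$, and let $$F(x)=\exp\left(-\int_x^\infty (t-x)\,u^2(t)\,dt\right)$$ be the cumulative distribution function of the Tracy–Widom distribution. Then the density function $F'$ of the Tracy–Widom distribution is log concave for $x\ge 0$; that is, $(\log F')''(x)\le 0$ for all $x\ge 0$.
   Context: The Tracy–Widom distribution is the distribution with cumulative distribution function $F$ given by the formula in the claim, where $u$ is a solution of the Painlevé II equation with the stated boundary conditions at $+\infty$. A twice-differentiable function $f:\mathbb R\to\mathbb R$ is concave at $x$ if $f''(x)\le 0$; a function $f$ taking only positive values is log concave at $x$ if $\log f$ is concave at $x$. *)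

(* Defs.v *)
From Stdlib Require Import Reals.
From Coquelicot Require Import Coquelicot.
Open Scope R_scope.

(* [Derive] is total and returns junk where the derivative does not exist,
   hence the explicit differentiability of both [f] and [Derive f]. *)
Definition twice_differentiable (f : R -> R) : Prop :=
  forall x : R, ex_derive f x /\ ex_derive (Derive f) x.

Definition painleve_II_solution (u : R -> R) : Prop :=
  twice_differentiable u /\
  forall x : R, Derive_n u 2 x = x * u x + 2 * u x ^ 3.

Definition tw_integrand (u : R -> R) (x t : R) : R := (t - x) * u t ^ 2.

(* The integral over [x, +oo) is an improper Riemann integral. [RInt_gen] is
   total: the formula is meaningful when [tw_integral_converges u x] holds. *)
Definition tw_integral_converges (u : R -> R) (x : R) : Prop :=
  ex_RInt_gen (tw_integrand u x) (at_point x) (Rbar_locally p_infty).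

Definition tracy_widom_cdf (u : R -> R) (x : R) : R :=
  exp (- RInt_gen (tw_integrand u x) (at_point x) (Rbar_locally p_infty)).

Definition tracy_widom_density (u : R -> R) : R -> R :=
  Derive (tracy_widom_cdf u).

Definition concave_at (f : R -> R) (x : R) : Prop :=
  twice_differentiable f /\ Derive_n f 2 x <= 0.

Definition log_concave_at (f : R -> R) (x : R) : Prop :=
  (forall y : R, 0 < f y) /\ concave_at (fun y => ln (f y)) x.

(* Main.v *)
(* Put [w = u'^2 - x u^2 - u^4], so that [w' = - u^2] and [w(x) = \int_x^oo u^2 > 0].
   Then [F' = w F] and [(log F')'' = - u^2 - (2 u u' w + u^4) / w^2], so it suffices that
   [2 u u' w + u^4 >= 0] for [x >= 0], i.e. that [w] is log concave there. This follows
   from log concavity of [u^2], and [(log u^2)'' = 2 (u^4 - w) / u^2]. Finally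
   [(w - u^4)' = - u^2 (1 + 4 u u')], where [u u'] is nondecreasing on [0, +oo), so
   [w >= u^4] reduces to [u u' >= - 1/4] at [0]. If that fails, [u] blows up at some
   negative [x], which is excluded because [u] is defined on the whole line. *)
Require Import Defs.
From Stdlib Require Import Reals Lra Psatz.
From Coquelicot Require Import Coquelicot.
Open Scope R_scope.

(* [auto_derive] leaves [Derive (fun t => f t) x], eta-expanded. *)
Ltac derive_subst :=
  repeat match goal with
  | H : is_derive ?f ?x _ |- context [Derive ?g ?x] =>
      replace (Derive g x) with (Derive f x) by reflexivity;
      rewrite (is_derive_unique _ _ _ H)
  end.

(** * Monotonicity and limits from the sign of a derivative *)

Lemma derive_nonneg_le (f df : R -> R) (a b : R) :
  a <= b ->
  (forall x, a <= x <= b -> is_derive f x (df x)) ->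
  (forall x, a < x < b -> 0 <= df x) ->
  f a <= f b.
Proof.
  intros [Hab | ->] Hd Hp; [| lra].
  destruct (MVT_cor2 f df a b Hab) as [c [E Hc]].
  - intros x Hx; apply is_derive_Reals, Hd, Hx.
  - assert (0 <= df c * (b - a)) by (apply Rmult_le_pos; [apply Hp | ]; lra).
    lra.
Qed.

(** A nonincreasing function dominates its limit at infinity. This stands in for integrating
    estimates over [[a, +oo)]. *)
Lemma derive_nonpos_lim0_nonneg (f df : R -> R) (a : R) :
  is_lim f p_infty 0 ->
  (forall x, a <= x -> is_derive f x (df x)) ->
  (forall x, a <= x -> df x <= 0) ->
  0 <= f a.
Proof.
  intros Hl Hd Hn.
  refine (is_lim_le_loc f (fun _ => f a) p_infty 0 (f a) _ Hl _).
  2: apply is_lim_const.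
  exists a; intros x Hx.
  enough (- f a <= - f x) by lra.
  apply (derive_nonneg_le (fun t => - f t) (fun t => - df t)); [lra | |].
  - intros t Ht; apply (is_derive_opp f), Hd; lra.
  - intros t Ht; specialize (Hn t ltac:(lra)); lra.
Qed.

Lemma nondecreasing_bounded_is_lim (f : R -> R) (a M : R) :
  (forall x y, a <= x <= y -> f x <= f y) ->
  (forall x, a <= x -> f x <= M) ->
  exists l : R, is_lim f p_infty l.
Proof.
  intros Hm HM.
  destruct (completeness (fun y => exists x, a <= x /\ y = f x)) as [l [Hub Hlub]].
  - exists M; intros y [x [Hx ->]]; apply HM, Hx.
  - exists (f a), a; split; [lra | reflexivity].
  - exists l; apply is_lim_spec; intros eps; destruct eps as [e He]; simpl.
    destruct (Classical_Prop.classic (exists x, a <= x /\ l - e < f x)) as [[x0 [Hx0 H0]] | N].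
    + exists x0; intros x Hx.
      assert (f x0 <= f x) by (apply Hm; lra).
      assert (f x <= l) by (apply Hub; exists x; split; [lra | reflexivity]).
      apply Rabs_def1; lra.
    + exfalso.
      assert (l <= l - e); [| lra].
      apply Hlub; intros y [x [Hx ->]].
      destruct (Rle_lt_dec (f x) (l - e)) as [H | H]; [exact H |].
      exfalso; apply N; exists x; split; assumption.
Qed.

(** * Continuous induction and finite-time blow-up *)

(** If positivity failed, the [T] with [f > 0] on [[0, T)] would have a supremum [s]; the step
    hypothesis gives [f s > 0], and continuity carries positivity past [s]. *)
Lemma positive_of_closed_open_induction (f : R -> R) :
  (forall y, 0 <= y -> continuous f y) ->
  (forall T, 0 <= T -> (forall y, 0 <= y < T -> 0 < f y) -> 0 < f T) ->
  forall y, 0 <= y -> 0 < f y.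
Proof.
  intros Hc Hs y1 Hy1.
  destruct (Rlt_le_dec 0 (f y1)) as [H | Hneg]; [exact H | exfalso].
  set (E := fun T => 0 <= T /\ forall y, 0 <= y < T -> 0 < f y).
  destruct (completeness E) as [s [Hub Hlub]].
  - exists y1; intros T [HT H].
    destruct (Rle_lt_dec T y1) as [h | h]; [exact h |].
    specialize (H y1 ltac:(lra)); lra.
  - exists 0; split; [lra | intros; lra].
  - assert (H0 : E 0) by (split; [lra | intros; lra]).
    assert (Hs0 : 0 <= s) by (apply Hub, H0).
    assert (Hlt : forall y, 0 <= y < s -> 0 < f y).
    { intros y Hy.
      destruct (Rlt_le_dec 0 (f y)) as [H | H]; [exact H | exfalso].
      assert (s <= y); [| lra].
      apply Hlub; intros T [HT HTE].
      destruct (Rle_lt_dec T y) as [h | h]; [exact h |].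
      specialize (HTE y ltac:(lra)); lra. }
    assert (Hfs := Hs s Hs0 Hlt).
    destruct (Hc s Hs0 (fun z => 0 < z) (open_gt 0 (f s) Hfs)) as [d Hd].
    assert (s + d / 2 <= s).
    { apply Hub; split; [destruct d; simpl; lra |].
      intros y Hy; destruct (Rlt_le_dec y s) as [h | h]; [apply Hlt; lra |].
      apply Hd. change (Rabs (y - s) < d).
      rewrite Rabs_pos_eq by lra; destruct d; simpl in *; lra. }
    destruct d; simpl in *; lra.
Qed.

(* While [v] stays above the line [c + v' 0 * y], where [c] is slightly smaller
   than [v 0] with still [4 * c * v' 0 > 1], AM-GM gives [v y ^ 2 > y], so [v] is
   convex and the line is never crossed. Then [v'' >= v ^ 3] for ever. *)
Lemma painleve_II_blow_up (v v' : R -> R) :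
  (forall y, is_derive v y (v' y)) ->
  (forall y, is_derive v' y (2 * v y ^ 3 - y * v y)) ->
  0 < v 0 -> 1 / 4 < v 0 * v' 0 -> v 0 ^ 4 <= v' 0 ^ 2 -> False.
Proof.
  intros Hv Hv' Ha Hab Hw.
  set (a := v 0) in *; set (b := v' 0) in *.
  assert (Hb : 0 < b) by nra.
  (* The midpoint of [a] and [1 / (4 b)]: since [a b > 1 / 4], it lies below [a] and still satisfies
     [4 c b > 1]. *)
  set (c := (a + / (4 * b)) / 2).
  assert (Hib : 0 < / (4 * b)) by (apply Rinv_0_lt_compat; lra).
  assert (Hib' : / (4 * b) * (4 * b) = 1) by (field; lra).
  assert (Hc : 0 < c < a) by (unfold c; nra).
  assert (Hcb : 1 < 4 * (c * b)) by (unfold c; nra).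
  assert (Hamgm : forall y, 0 <= y -> c + b * y < v y -> y < v y ^ 2).
  { intros y Hy H.
    assert (0 <= b * y) by nra.
    assert ((c + b * y) ^ 2 < v y ^ 2) by nra.
    assert (0 <= (c - b * y) ^ 2) by apply pow2_ge_0.
    nra. }
  assert (Hslope : forall T, 0 <= T ->
     (forall y, 0 <= y < T -> c + b * y < v y) ->
     forall y, 0 <= y <= T -> b <= v' y).
  { intros T HT H y Hy.
    apply (derive_nonneg_le v' (fun y => 2 * v y ^ 3 - y * v y) 0 y);
      [lra | intros; apply Hv' |].
    intros x Hx; specialize (H x ltac:(lra)).
    assert (0 < v x) by nra.
    assert (x < v x ^ 2) by (apply Hamgm; lra).
    assert (0 <= v x * (v x ^ 2 - x)) by (apply Rmult_le_pos; lra).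
    nra. }
  assert (Hline : forall y, 0 <= y -> 0 < v y - c - b * y).
  { apply positive_of_closed_open_induction.
    - intros y _. apply (ex_derive_continuous (fun y => v y - c - b * y)).
      auto_derive; eexists; apply Hv.
    - intros T HT H.
      assert (Hs := Hslope T HT ltac:(intros y Hy; specialize (H y Hy); lra)).
      (* The gap [a - c] present at 0 never shrinks up to [T], so the inequality stays strict at
         [T]. *)
      assert (a - b * 0 <= v T - b * T); [| lra].
      apply (derive_nonneg_le (fun t => v t - b * t) (fun t => v' t - b) 0 T);
        [lra | |].
      + intros x _. assert (Hx := Hv x). auto_derive; [eexists; apply Hx |].
        derive_subst; ring.
      + intros x Hx; specialize (Hs x ltac:(lra)); lra. }
  assert (Hall : forall y, 0 <= y -> c < v y /\ b <= v' y /\ y < v y ^ 2).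
  { intros y Hy; repeat split.
    - specialize (Hline y Hy); nra.
    - apply (Hslope y Hy); [| lra].
      intros z Hz; specialize (Hline z ltac:(lra)); lra.
    - apply Hamgm; [exact Hy | specialize (Hline y Hy); lra]. }
  (* The energy [v' ^ 2 - v ^ 4 / 2] is nondecreasing because [v ^ 2 > y], and it starts nonnegative
     because [a ^ 4 <= b ^ 2]. *)
  assert (Henergy : forall y, 0 <= y -> v y ^ 4 / 2 <= v' y ^ 2).
  { intros y Hy.
    assert (b ^ 2 - a ^ 4 / 2 <= v' y ^ 2 - v y ^ 4 / 2); [| assert (0 <= a ^ 4) by (apply pow_le; lra); lra].
    apply (derive_nonneg_le (fun t => v' t ^ 2 - v t ^ 4 / 2)
      (fun t => 2 * v' t * v t * (v t ^ 2 - t)) 0 y); [lra | |].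
    - intros x _. assert (Hx := Hv x); assert (Hx' := Hv' x).
      auto_derive; [repeat split; eexists; eassumption |].
      derive_subst. field.
    - intros x Hx; destruct (Hall x ltac:(lra)) as [? [? ?]].
      repeat apply Rmult_le_pos; lra. }
  (* The energy bound yields the Riccati inequality [v' >= v ^ 2 / 2], so [1 / v] falls at rate at
     least [1 / 2]. Starting from [1 / a], it would be nonpositive by [y = 2 / a]. *)
  assert (Hinv : forall y, 0 <= y -> - / a <= - / v y - y / 2).
  { intros y Hy.
    replace (- / a) with (- / v 0 - 0 / 2) by (fold a; lra).
    apply (derive_nonneg_le (fun t => - / v t - t / 2)
      (fun t => v' t / v t ^ 2 - / 2) 0 y); [lra | |].
    - intros x Hx. destruct (Hall x ltac:(lra)) as [? _]. assert (Hd := Hv x).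
      auto_derive; [repeat split; [eexists; eassumption | lra] |].
      derive_subst. field; lra.
    - intros x Hx. destruct (Hall x ltac:(lra)) as [Hx1 [Hx2 _]].
      specialize (Henergy x ltac:(lra)).
      assert (0 < v x ^ 2) by nra.
      assert (v x ^ 2 / 2 <= v' x) by nra.
      apply Rmult_le_reg_r with (v x ^ 2); [assumption |].
      replace ((v' x / v x ^ 2 - / 2) * v x ^ 2) with (v' x - v x ^ 2 / 2) by (field; lra).
      lra. }
  assert (0 < / a) by (apply Rinv_0_lt_compat; exact Ha).
  specialize (Hinv (2 / a) ltac:(unfold Rdiv; lra)).
  destruct (Hall (2 / a) ltac:(unfold Rdiv; lra)) as [Hva _].
  assert (0 < / v (2 / a)) by (apply Rinv_0_lt_compat; lra).
  unfold Rdiv in *; lra.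
Qed.

(** * Decaying solutions and the tail mass of [u ^ 2] *)

Record decaying_painleve_II (u q : R -> R) : Prop := {
  dp_u : forall x, is_derive u x (q x);
  dp_q : forall x, is_derive q x (x * u x + 2 * u x ^ 3);
  dp_u_lim : is_lim u p_infty 0;
  dp_q_lim : is_lim q p_infty 0 }.

Lemma decaying_painleve_II_of_solution (u : R -> R) :
  painleve_II_solution u -> is_lim u p_infty 0 -> is_lim (Derive u) p_infty 0 ->
  decaying_painleve_II u (Derive u).
Proof.
  intros [Hd He] Hu Hq; split; [ | | exact Hu | exact Hq].
  - intros x; apply Derive_correct, Hd.
  - intros x; rewrite <- He; apply (Derive_correct (Derive u)), Hd.
Qed.

(* The tail integral of [u ^ 2] over [x, +oo) in closed form. *)
Definition tail_mass (u q : R -> R) (x : R) : R :=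
  q x ^ 2 - x * u x ^ 2 - u x ^ 4.

Lemma is_derive_tail_mass (u q : R -> R) (x : R) :
  decaying_painleve_II u q -> is_derive (tail_mass u q) x (- u x ^ 2).
Proof.
  intros [Hu Hq _ _]; specialize (Hu x); specialize (Hq x); unfold tail_mass.
  auto_derive; [repeat split; eexists; eassumption |].
  derive_subst; ring.
Qed.

Lemma is_derive_mult_self_deriv (u q : R -> R) (x : R) :
  decaying_painleve_II u q ->
  is_derive (fun t => 2 * u t * q t) x (2 * q x ^ 2 + 2 * x * u x ^ 2 + 4 * u x ^ 4).
Proof.
  intros [Hu Hq _ _]; specialize (Hu x); specialize (Hq x).
  auto_derive; [repeat split; eexists; eassumption |].
  derive_subst; ring.
Qed.

Lemma tail_mass_nonincreasing (u q : R -> R) (x y : R) :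
  decaying_painleve_II u q -> x <= y -> tail_mass u q y <= tail_mass u q x.
Proof.
  intros H Hxy.
  enough (- tail_mass u q x <= - tail_mass u q y) by lra.
  apply (derive_nonneg_le (fun t => - tail_mass u q t) (fun t => - - u t ^ 2)); [lra | |].
  - intros t _; apply (is_derive_opp (tail_mass u q)), is_derive_tail_mass, H.
  - intros t _; assert (0 <= u t ^ 2) by apply pow2_ge_0; lra.
Qed.

Lemma is_lim_mult_0 (f g : R -> R) :
  is_lim f p_infty 0 -> is_lim g p_infty 0 -> is_lim (fun x => f x * g x) p_infty 0.
Proof.
  intros Hf Hg.
  replace (Finite 0) with (Rbar_mult 0 0) by (simpl; f_equal; ring).
  apply is_lim_mult; [exact Hf | exact Hg | exact I].
Qed.

Lemma is_lim_scal_0 (f : R -> R) (c : R) :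
  is_lim f p_infty 0 -> is_lim (fun x => c * f x) p_infty 0.
Proof.
  intros Hf.
  replace (Finite 0) with (Rbar_mult c 0) by (simpl; f_equal; ring).
  apply is_lim_scal_l, Hf.
Qed.

Lemma is_lim_mult_self_deriv (u q : R -> R) :
  decaying_painleve_II u q -> is_lim (fun x => 2 * u x * q x) p_infty 0.
Proof.
  intros [_ _ Hu Hq]; apply (is_lim_mult_0 (fun x => 2 * u x)); [| exact Hq].
  apply is_lim_scal_0, Hu.
Qed.

(* If [tail_mass] were negative somewhere, the identity
   [(u ^ 2)'' = 4 * u' ^ 2 + 2 * u ^ 4 - 2 * tail_mass] would make [(u ^ 2)'] unbounded. *)
Lemma tail_mass_nonneg (u q : R -> R) (x : R) :
  decaying_painleve_II u q -> 0 <= tail_mass u q x.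
Proof.
  intros H.
  destruct (Rle_lt_dec 0 (tail_mass u q x)) as [h | h]; [exact h | exfalso].
  set (e := - tail_mass u q x).
  assert (Hlim := is_lim_mult_self_deriv u q H).
  apply is_lim_spec in Hlim; destruct (Hlim (mkposreal 1 Rlt_0_1)) as [M HM]; simpl in HM.
  set (p' := 2 * u x * q x) in *.
  (* Beyond [M] one has [|2 u q| < 1], while to the right of [x] the function [2 u q] grows at rate
     at least [2 e]. The second argument of [Rmax] leaves room for it to climb from [p'] to at least
     1. *)
  set (y := Rmax (M + 1) (x + (1 + Rabs p') / (2 * e))).
  assert (He : 0 < e) by (unfold e; lra).
  assert (Hap : 0 <= Rabs p') by apply Rabs_pos.
  assert (0 < (1 + Rabs p') / (2 * e)) by (apply Rdiv_lt_0_compat; lra).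
  assert (Hy1 : M + 1 <= y) by apply Rmax_l.
  assert (Hy2 : x + (1 + Rabs p') / (2 * e) <= y) by apply Rmax_r.
  assert (Hg : 2 * u x * q x - 2 * e * x <= 2 * u y * q y - 2 * e * y).
  { apply (derive_nonneg_le (fun t => 2 * u t * q t - 2 * e * t)
      (fun t => 2 * q t ^ 2 + 2 * t * u t ^ 2 + 4 * u t ^ 4 - 2 * e)); [lra | |].
    - intros t _.
      apply (is_derive_minus (fun t => 2 * u t * q t) (fun t => 2 * e * t));
        [apply is_derive_mult_self_deriv, H |].
      auto_derive; [exact I |]; ring.
    - intros t Ht.
      assert (Hw := tail_mass_nonincreasing u q x t H ltac:(lra)).
      assert (0 <= q t ^ 2) by apply pow2_ge_0.
      assert (0 <= (u t ^ 2) ^ 2) by apply pow2_ge_0.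
      change (q t ^ 2 - t * u t ^ 2 - u t ^ 4 <= tail_mass u q x) in Hw.
      unfold e; nra. }
  specialize (HM y ltac:(lra)); apply Rabs_def2 in HM.
  fold p' in Hg.
  assert (1 + Rabs p' <= 2 * e * (y - x)).
  { apply Rmult_le_reg_r with (/ (2 * e)); [apply Rinv_0_lt_compat; lra |].
    replace (2 * e * (y - x) * / (2 * e)) with (y - x) by (field; lra).
    unfold Rdiv in *; lra. }
  assert (- p' <= Rabs p') by (rewrite <- Rabs_Ropp; apply Rle_abs).
  lra.
Qed.

(** The hypotheses give no direct limit for [x * u x ^ 2]. For [x > 0] its sign suffices: the tail
    mass is squeezed between 0 and [q ^ 2]. *)
Lemma is_lim_tail_mass (u q : R -> R) :
  decaying_painleve_II u q -> is_lim (tail_mass u q) p_infty 0.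
Proof.
  intros H.
  apply (is_lim_le_le_loc (fun _ => 0) (fun x => q x * q x)).
  - exists 0; intros x Hx; split; [apply tail_mass_nonneg, H |].
    unfold tail_mass.
    assert (0 <= u x ^ 2) by apply pow2_ge_0.
    assert (0 <= (u x ^ 2) ^ 2) by apply pow2_ge_0.
    nra.
  - apply is_lim_const.
  - apply is_lim_mult_0; apply (dp_q_lim _ _ H).
Qed.

(** A backward Gronwall argument: [C] bounds the coefficient of [2 u q] in [(u ^ 2 + q ^ 2)'] on
    [[a, b]], so [(u ^ 2 + q ^ 2) * exp (C t)] is nondecreasing there and vanishes at [b]. *)
Lemma painleve_II_zero_unique (u q : R -> R) (b : R) :
  decaying_painleve_II u q -> u b = 0 -> q b = 0 -> forall a, a <= b -> u a = 0.
Proof.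
  intros [Hu Hq _ _] Hub Hqb a Hab.
  destruct (continuity_ab_maj (fun t => Rabs (t + 2 * u t ^ 2)) a b Hab) as [m [Hm _]].
  { intros c _; apply continuity_pt_filterlim.
    apply (continuous_comp (fun t => t + 2 * u t ^ 2) Rabs); [| apply continuous_Rabs].
    apply (ex_derive_continuous (fun t => t + 2 * u t ^ 2)).
    auto_derive; eexists; apply Hu. }
  set (C := 1 + Rabs (m + 2 * u m ^ 2)) in *.
  assert (Hmono : (u a ^ 2 + q a ^ 2) * exp (C * a) <= (u b ^ 2 + q b ^ 2) * exp (C * b)).
  { apply (derive_nonneg_le (fun t => (u t ^ 2 + q t ^ 2) * exp (C * t))
      (fun t => (2 * u t * q t * (1 + (t + 2 * u t ^ 2)) + C * (u t ^ 2 + q t ^ 2))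
                * exp (C * t))); [exact Hab | |].
    - intros t _. specialize (Hu t); specialize (Hq t).
      auto_derive; [repeat split; eexists; eassumption |].
      derive_subst; ring.
    - intros t Ht; apply Rmult_le_pos; [| apply Rlt_le, exp_pos].
      specialize (Hm t ltac:(lra)).
      assert (Hk : Rabs (1 + (t + 2 * u t ^ 2)) <= C).
      { eapply Rle_trans; [apply Rabs_triang |].
        rewrite (Rabs_pos_eq 1) by lra; unfold C; lra. }
      apply Rabs_le_between in Hk.
      set (k := 1 + (t + 2 * u t ^ 2)) in *.
      (* The two weighted squares add up to [2 (C (u ^ 2 + q ^ 2) + 2 k u q)]. *)
      assert (0 <= (C - k) * (u t - q t) ^ 2)
        by (apply Rmult_le_pos; [lra | apply pow2_ge_0]).
      assert (0 <= (C + k) * (u t + q t) ^ 2)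
        by (apply Rmult_le_pos; [lra | apply pow2_ge_0]).
      nra. }
  rewrite Hub, Hqb in Hmono.
  assert (0 < exp (C * a)) by apply exp_pos.
  assert (0 <= u a ^ 2) by apply pow2_ge_0.
  assert (0 <= q a ^ 2) by apply pow2_ge_0.
  assert (u a ^ 2 <= 0) by nra.
  nra.
Qed.

(** If the tail mass is not positive at [y], monotonicity and nonnegativity make it 0 on [(y, +oo)].
    Its derivative [- u ^ 2] then vanishes there, and backward uniqueness makes [u] zero
    everywhere. *)
Lemma tail_mass_pos (u q : R -> R) (y : R) :
  decaying_painleve_II u q -> (exists x, u x <> 0) -> 0 < tail_mass u q y.
Proof.
  intros H [x Hx].
  destruct (Rlt_le_dec 0 (tail_mass u q y)) as [h | h]; [exact h | exfalso].
  assert (Hw : forall t, y < t -> tail_mass u q t = 0).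
  { intros t Ht.
    assert (A := tail_mass_nonneg u q t H).
    assert (B := tail_mass_nonincreasing u q y t H ltac:(lra)).
    lra. }
  assert (Hu0 : forall t, y < t -> u t = 0).
  { intros t Ht.
    assert (D : is_derive (tail_mass u q) t 0).
    { apply (is_derive_ext_loc (fun _ => 0)); [| apply @is_derive_const].
      assert (Hd : 0 < t - y) by lra.
      exists (mkposreal _ Hd); intros z Hz; symmetry; apply Hw.
      change (Rabs (z - t) < t - y) in Hz; apply Rabs_def2 in Hz; lra. }
    assert (E := is_derive_unique _ _ _ D).
    rewrite (is_derive_unique _ _ _ (is_derive_tail_mass u q t H)) in E.
    nra. }
  (* Uniqueness propagates leftwards, so [b] must lie beyond [y] and not to the left of [x]. *)
  set (b := Rmax (y + 1) x).
  assert (Hb1 : y + 1 <= b) by apply Rmax_l.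
  assert (Hb2 : x <= b) by apply Rmax_r.
  apply Hx, (painleve_II_zero_unique u q b); [exact H | apply Hu0; lra | | exact Hb2].
  assert (Hwb := Hw b ltac:(lra)); unfold tail_mass in Hwb.
  rewrite (Hu0 b) in Hwb by lra; nra.
Qed.

(** * Convergence of the Tracy-Widom integral *)

Definition first_moment (u : R -> R) (x : R) : R := RInt (fun t => t * u t ^ 2) 0 x.

Lemma is_derive_first_moment (u q : R -> R) (x : R) :
  decaying_painleve_II u q -> is_derive (first_moment u) x (x * u x ^ 2).
Proof.
  intros H.
  assert (Hc : forall z, continuous (fun t => t * u t ^ 2) z).
  { intros z; apply (ex_derive_continuous (fun t => t * u t ^ 2)).
    auto_derive; eexists; apply (dp_u _ _ H). }
  apply (is_derive_RInt (fun t => t * u t ^ 2) _ 0).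
  - exists (mkposreal 1 Rlt_0_1); intros z _.
    apply (RInt_correct (fun t => t * u t ^ 2)), ex_RInt_continuous.
    intros; apply Hc.
  - apply Hc.
Qed.

(** On [[0, +oo)] the function [2 u q = (u ^ 2)'] is nondecreasing and tends to 0. *)
Lemma mult_self_deriv_nonpos (u q : R -> R) (x : R) :
  decaying_painleve_II u q -> 0 <= x -> 2 * u x * q x <= 0.
Proof.
  intros H Hx.
  enough (0 <= - (2 * u x * q x)) by lra.
  apply (derive_nonpos_lim0_nonneg (fun t => - (2 * u t * q t))
    (fun t => - (2 * q t ^ 2 + 2 * t * u t ^ 2 + 4 * u t ^ 4))).
  - replace (Finite 0) with (Rbar_opp 0) by (simpl; f_equal; ring).
    apply (is_lim_opp (fun t => 2 * u t * q t)), is_lim_mult_self_deriv, H.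
  - intros t _; apply (is_derive_opp (fun t => 2 * u t * q t)), is_derive_mult_self_deriv, H.
  - intros t Ht.
    assert (0 <= q t ^ 2) by apply pow2_ge_0.
    assert (0 <= (u t ^ 2) ^ 2) by apply pow2_ge_0.
    assert (0 <= t * u t ^ 2) by (apply Rmult_le_pos; [lra | apply pow2_ge_0]).
    nra.
Qed.

(** Monotone convergence: [(u q)' >= t u ^ 2] makes [u q - first_moment u] nondecreasing, and
    [u q <= 0] turns this into an upper bound for the moment. *)
Lemma is_lim_first_moment (u q : R -> R) :
  decaying_painleve_II u q -> exists l : R, is_lim (first_moment u) p_infty l.
Proof.
  intros H.
  apply (nondecreasing_bounded_is_lim _ 0 (first_moment u 0 - u 0 * q 0)).
  - intros x y Hxy; apply (derive_nonneg_le _ (fun t => t * u t ^ 2)); [lra | |].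
    + intros t _; apply (is_derive_first_moment u q), H.
    + intros t Ht; apply Rmult_le_pos; [lra | apply pow2_ge_0].
  - intros x Hx.
    assert (Hn := mult_self_deriv_nonpos u q x H Hx).
    assert (2 * u 0 * q 0 - 2 * first_moment u 0 <= 2 * u x * q x - 2 * first_moment u x);
      [| lra].
    apply (derive_nonneg_le (fun t => 2 * u t * q t - 2 * first_moment u t)
      (fun t => 2 * q t ^ 2 + 2 * t * u t ^ 2 + 4 * u t ^ 4 - 2 * (t * u t ^ 2)));
      [exact Hx | |].
    + intros t _.
      apply (is_derive_minus (fun t => 2 * u t * q t) (fun t => 2 * first_moment u t));
        [apply is_derive_mult_self_deriv, H |].
      apply (is_derive_scal (first_moment u)), (is_derive_first_moment u q), H.
    + intros t Ht.
      assert (0 <= q t ^ 2) by apply pow2_ge_0.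
      assert (0 <= (u t ^ 2) ^ 2) by apply pow2_ge_0.
      nra.
Qed.

Lemma is_RInt_gen_tw_integrand (u q : R -> R) (l x : R) :
  decaying_painleve_II u q -> is_lim (first_moment u) p_infty l ->
  is_RInt_gen (tw_integrand u x) (at_point x) (Rbar_locally p_infty)
    (l - first_moment u x - x * tail_mass u q x).
Proof.
  intros H Hl P HP.
  (* With [x] frozen, [g] is an antiderivative of [(t - x) u ^ 2], so the improper integral is the
     limit of [g] minus [g x]. *)
  set (g := fun t => first_moment u t + x * tail_mass u q t).
  assert (Hg : is_lim (fun b => g b - g x) p_infty
    (l - first_moment u x - x * tail_mass u q x)).
  { replace (Finite (l - first_moment u x - x * tail_mass u q x))
      with (Finite ((l + x * 0) - g x)) by (unfold g; f_equal; ring).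
    apply (is_lim_minus' g (fun _ => g x)); [| apply is_lim_const].
    apply (is_lim_plus' (first_moment u) (fun t => x * tail_mass u q t)); [exact Hl |].
    apply (is_lim_scal_l (tail_mass u q) x p_infty 0), is_lim_tail_mass, H. }
  assert (Hint : forall b, is_RInt (tw_integrand u x) x b (g b - g x)).
  { intros b; apply (is_RInt_derive g (tw_integrand u x)).
    - intros t _.
      replace (tw_integrand u x t) with (t * u t ^ 2 + x * - u t ^ 2)
        by (unfold tw_integrand; ring).
      apply (is_derive_plus (first_moment u) (fun t => x * tail_mass u q t));
        [apply (is_derive_first_moment u q), H |].
      apply (is_derive_scal (tail_mass u q)), is_derive_tail_mass, H.
    - intros t _; apply (ex_derive_continuous (tw_integrand u x)).
      unfold tw_integrand; auto_derive; eexists; apply (dp_u _ _ H). }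
  destruct (Hg P HP) as [M HM].
  apply (Filter_prod _ _ _ (fun a => a = x) (fun b => M < b));
    [reflexivity | exists M; intros; assumption |].
  intros a b -> Hb; exists (g b - g x); split; [apply Hint | apply HM, Hb].
Qed.

(** * Bounds on [u u'] and nonvanishing on the positive half-line *)

(** Otherwise the reflection [s * u (- y)], with [s] the sign of [u 0], meets the blow-up criterion;
    its condition [v 0 ^ 4 <= v' 0 ^ 2] is nonnegativity of the tail mass at 0. *)
Lemma mult_deriv_at_0_ge (u q : R -> R) :
  decaying_painleve_II u q -> - (1 / 4) <= u 0 * q 0.
Proof.
  intros H.
  destruct (Rle_lt_dec (- (1 / 4)) (u 0 * q 0)) as [h | h]; [exact h | exfalso].
  assert (Hs : exists s, s ^ 2 = 1 /\ 0 < s * u 0).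
  { destruct (Rtotal_order (u 0) 0) as [h0 | [h0 | h0]].
    - exists (-1); lra.
    - rewrite h0 in h; lra.
    - exists 1; lra. }
  destruct Hs as [s [Hs Hs0]].
  apply (painleve_II_blow_up (fun y => s * u (- y)) (fun y => - s * q (- y)));
    rewrite ?Ropp_0; [ | | exact Hs0 | nra |].
  - intros y; assert (Hu := dp_u _ _ H (- y)).
    auto_derive; [eexists; eassumption |]; derive_subst; ring.
  - intros y; assert (Hq := dp_q _ _ H (- y)).
    auto_derive; [eexists; eassumption |]; derive_subst.
    replace (2 * (s * u (- y)) ^ 3) with (2 * s * s ^ 2 * u (- y) ^ 3) by ring.
    rewrite Hs; ring.
  - assert (Hw := tail_mass_nonneg u q 0 H); unfold tail_mass in Hw.
    replace ((s * u 0) ^ 4) with ((s ^ 2) ^ 2 * u 0 ^ 4) by ring.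
    replace ((- s * q 0) ^ 2) with (s ^ 2 * q 0 ^ 2) by ring.
    rewrite Hs; lra.
Qed.

Lemma mult_deriv_ge (u q : R -> R) (x : R) :
  decaying_painleve_II u q -> 0 <= x -> - (1 / 4) <= u x * q x.
Proof.
  intros H Hx.
  assert (H0 := mult_deriv_at_0_ge u q H).
  assert (2 * u 0 * q 0 <= 2 * u x * q x); [| lra].
  apply (derive_nonneg_le (fun t => 2 * u t * q t)
    (fun t => 2 * q t ^ 2 + 2 * t * u t ^ 2 + 4 * u t ^ 4)); [exact Hx | |].
  - intros t _; apply is_derive_mult_self_deriv, H.
  - intros t Ht.
    assert (0 <= q t ^ 2) by apply pow2_ge_0.
    assert (0 <= (u t ^ 2) ^ 2) by apply pow2_ge_0.
    assert (0 <= t * u t ^ 2) by (apply Rmult_le_pos; [lra | apply pow2_ge_0]).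
    nra.
Qed.

Lemma pow4_le_tail_mass (u q : R -> R) (x : R) :
  decaying_painleve_II u q -> 0 <= x -> u x ^ 4 <= tail_mass u q x.
Proof.
  intros H Hx.
  (* The fourth power is written as nested products so that its limit follows by repeated use of
     [is_lim_mult_0]. *)
  enough (0 <= tail_mass u q x - u x * (u x * (u x * u x))) by lra.
  apply (derive_nonpos_lim0_nonneg
    (fun t => tail_mass u q t - u t * (u t * (u t * u t)))
    (fun t => - u t ^ 2 - 4 * u t ^ 3 * q t)).
  - replace (Finite 0) with (Finite (0 - 0)) by (f_equal; ring).
    apply (is_lim_minus' (tail_mass u q)); [apply is_lim_tail_mass, H |].
    repeat apply is_lim_mult_0; apply (dp_u_lim _ _ H).
  - intros t _.
    apply (is_derive_minus (tail_mass u q)); [apply is_derive_tail_mass, H |].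
    assert (Hu := dp_u _ _ H t).
    auto_derive; [repeat split; eexists; eassumption |].
    derive_subst; ring.
  - intros t Ht.
    assert (Hm := mult_deriv_ge u q t H ltac:(lra)).
    assert (0 <= u t ^ 2 * (1 + 4 * (u t * q t)))
      by (apply Rmult_le_pos; [apply pow2_ge_0 | lra]).
    nra.
Qed.

(** Since [u ^ 2] is nonincreasing on [[0, +oo)], a zero at [x] would persist to the right. The tail
    mass would be constant there with limit 0, against its positivity. *)
Lemma decaying_painleve_II_neq_0 (u q : R -> R) (x : R) :
  decaying_painleve_II u q -> (exists x, u x <> 0) -> 0 <= x -> u x <> 0.
Proof.
  intros H Hnz Hx Hux.
  assert (Hle : forall t, x <= t -> u t ^ 2 <= 0).
  { intros t Ht.
    enough (- u x ^ 2 <= - u t ^ 2) by (rewrite Hux in *; lra).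
    apply (derive_nonneg_le (fun t => - u t ^ 2) (fun t => - (2 * u t * q t)));
      [exact Ht | |].
    - intros z _; assert (Hu := dp_u _ _ H z).
      auto_derive; [eexists; eassumption |]; derive_subst; ring.
    - intros z Hz; assert (Hn := mult_self_deriv_nonpos u q z H ltac:(lra)); lra. }
  assert (Hw := tail_mass_pos u q x H Hnz).
  assert (0 <= - tail_mass u q x); [| lra].
  apply (derive_nonpos_lim0_nonneg (fun t => - tail_mass u q t) (fun t => - - u t ^ 2)).
  - replace (Finite 0) with (Rbar_opp 0) by (simpl; f_equal; ring).
    apply (is_lim_opp (tail_mass u q)), is_lim_tail_mass, H.
  - intros t _; apply (is_derive_opp (tail_mass u q)), is_derive_tail_mass, H.
  - intros t Ht; specialize (Hle t Ht); lra.
Qed.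

(** * Log concavity of [u ^ 2] and of the tail mass *)

(** By the equation, [(u' / u)' = (u ^ 4 - w) / u ^ 2] with [w] the tail mass, and [u ^ 4 <= w] on
    [[0, +oo)]. *)
Lemma log_deriv_nonincreasing (u q : R -> R) (x y : R) :
  decaying_painleve_II u q -> (exists x, u x <> 0) -> 0 <= x <= y ->
  q y / u y <= q x / u x.
Proof.
  intros H Hnz Hxy.
  enough (- (q x / u x) <= - (q y / u y)) by lra.
  apply (derive_nonneg_le (fun t => - (q t / u t))
    (fun t => (tail_mass u q t - u t ^ 4) / u t ^ 2)); [lra | |].
  - intros t Ht; assert (Hu := dp_u _ _ H t); assert (Hq := dp_q _ _ H t).
    assert (N := decaying_painleve_II_neq_0 u q t H Hnz ltac:(lra)).
    auto_derive; [repeat split; try (eexists; eassumption); exact N |].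
    derive_subst; unfold tail_mass; field; exact N.
  - intros t Ht.
    assert (N := decaying_painleve_II_neq_0 u q t H Hnz ltac:(lra)).
    assert (P := pow4_le_tail_mass u q t H ltac:(lra)).
    apply Rdiv_le_0_compat; [lra | apply pow2_gt_0, N].
Qed.

(* With [r = - u' / u] nondecreasing,
   [u x ^ 2 = \int_x^oo 2 r u ^ 2 >= 2 r x \int_x^oo u ^ 2 = 2 r x * tail_mass x]. *)
Lemma tail_mass_log_concave (u q : R -> R) (x : R) :
  decaying_painleve_II u q -> (exists x, u x <> 0) -> 0 <= x ->
  0 <= 2 * u x * q x * tail_mass u q x + u x ^ 4.
Proof.
  intros H Hnz Hx.
  assert (N := decaying_painleve_II_neq_0 u q x H Hnz Hx).
  set (c := q x / u x).
  (* With the logarithmic derivative frozen at its value [c] at [x], the function [u ^ 2 + 2 c w]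
     has derivative [2 u ^ 2 (q / u - c) <= 0] on [[x, +oo)] and tends to 0. *)
  assert (HK : 0 <= u x * u x + 2 * c * tail_mass u q x).
  { apply (derive_nonpos_lim0_nonneg
      (fun t => u t * u t + 2 * c * tail_mass u q t)
      (fun t => 2 * u t * q t + 2 * c * - u t ^ 2)).
    - replace (Finite 0) with (Finite (0 + 0)) by (f_equal; ring).
      apply (is_lim_plus' (fun t => u t * u t)).
      + apply is_lim_mult_0; apply (dp_u_lim _ _ H).
      + apply is_lim_scal_0, is_lim_tail_mass, H.
    - intros t _.
      apply (is_derive_plus (fun t => u t * u t) (fun t => 2 * c * tail_mass u q t)).
      + assert (Hu := dp_u _ _ H t).
        auto_derive; [repeat split; eexists; eassumption |]; derive_subst; ring.
      + apply (is_derive_scal (tail_mass u q)), is_derive_tail_mass, H.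
    - intros t Ht.
      assert (Nt := decaying_painleve_II_neq_0 u q t H Hnz ltac:(lra)).
      assert (Hr := log_deriv_nonincreasing u q x t H Hnz ltac:(lra)).
      replace (q t) with (q t / u t * u t) by (field; exact Nt).
      fold c in Hr.
      assert (0 <= (c - q t / u t) * u t ^ 2)
        by (apply Rmult_le_pos; [lra | apply pow2_ge_0]).
      nra. }
  replace (2 * u x * q x * tail_mass u q x + u x ^ 4)
    with (u x ^ 2 * (u x * u x + 2 * c * tail_mass u q x)) by (unfold c; field; exact N).
  apply Rmult_le_pos; [apply pow2_ge_0 | exact HK].
Qed.

Theorem theorem5p1 (u : R -> R)
  (u_nonzero : exists x : R, u x <> 0)
  (u_painleve : painleve_II_solution u)
  (u_lim : is_lim u p_infty 0)
  (u'_lim : is_lim (Derive u) p_infty 0) :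
  (forall x : R, tw_integral_converges u x) /\
  (forall x : R, ex_derive (tracy_widom_cdf u) x) /\
  (forall x : R, 0 <= x -> log_concave_at (tracy_widom_density u) x).
Proof.
  assert (H := decaying_painleve_II_of_solution u u_painleve u_lim u'_lim).
  set (q := Derive u) in *.
  destruct (is_lim_first_moment u q H) as [l Hl].
  set (w := tail_mass u q).
  assert (Hw : forall x, is_derive w x (- u x ^ 2))
    by (intros x; apply is_derive_tail_mass, H).
  assert (Hwpos : forall x, 0 < w x) by (intros x; apply tail_mass_pos; assumption).
  (* The value of the Tracy-Widom integral, so that [F = exp (- G)]. In [G'] the two terms
     [x * u x ^ 2] cancel, leaving [- w]. *)
  set (G := fun x => l - first_moment u x - x * w x).
  assert (HG : forall x, is_derive G x (- w x)).
  { intros x; assert (Hf := is_derive_first_moment u q x H); specialize (Hw x).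
    unfold G; auto_derive; [repeat split; eexists; eassumption |].
    derive_subst; ring. }
  assert (Hint : forall x, is_RInt_gen (tw_integrand u x) (at_point x)
    (Rbar_locally p_infty) (G x))
    by (intros x; apply is_RInt_gen_tw_integrand; assumption).
  assert (HF : forall x, is_derive (tracy_widom_cdf u) x (w x * exp (- G x))).
  { intros x; apply (is_derive_ext (fun y => exp (- G y))).
    - intros y; unfold tracy_widom_cdf.
      rewrite (is_RInt_gen_unique _ _ (Hint y)); reflexivity.
    - specialize (HG x); auto_derive; [eexists; eassumption |].
      derive_subst; ring. }
  assert (Hdens : forall x, tracy_widom_density u x = w x * exp (- G x))
    by (intros x; apply is_derive_unique, HF).
  assert (Hpos : forall x, 0 < tracy_widom_density u x).
  { intros x; rewrite Hdens; apply Rmult_lt_0_compat; [apply Hwpos | apply exp_pos]. }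
  (* From [F' = w * exp (- G)] one gets [log F' = log w - G], which is differentiated termwise. *)
  assert (Hln : forall x, is_derive (fun y => ln (tracy_widom_density u y)) x
    (w x - u x ^ 2 / w x)).
  { intros x; apply (is_derive_ext (fun y => ln (w y) - G y)).
    - intros y; rewrite Hdens, ln_mult, ln_exp; [| apply Hwpos | apply exp_pos].
      reflexivity.
    - specialize (HG x); specialize (Hw x); specialize (Hwpos x).
      auto_derive; [repeat split; try (eexists; eassumption); exact Hwpos |].
      derive_subst; field; lra. }
  assert (Hln2 : forall x, is_derive (Derive (fun y => ln (tracy_widom_density u y))) x
    (- u x ^ 2 - (2 * u x * q x * w x + u x ^ 4) / w x ^ 2)).
  { intros x; apply (is_derive_ext (fun y => w y - u y ^ 2 / w y)).
    - intros y; symmetry; apply is_derive_unique, Hln.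
    - assert (Hu := dp_u _ _ H x); specialize (Hw x); specialize (Hwpos x).
      auto_derive; [repeat split; try (eexists; eassumption); lra |].
      derive_subst; field; lra. }
  split; [| split].
  - intros x; exists (G x); apply Hint.
  - intros x; eexists; apply HF.
  - intros x Hx; split; [exact Hpos |]; split.
    + intros y; split; eexists; [apply Hln | apply Hln2].
    + change (Derive (Derive (fun y => ln (tracy_widom_density u y))) x <= 0).
      rewrite (is_derive_unique _ _ _ (Hln2 x)).
      assert (Hk := tail_mass_log_concave u q x H u_nonzero Hx); fold w in Hk.
      assert (0 <= u x ^ 2) by apply pow2_ge_0.
      assert (0 <= (2 * u x * q x * w x + u x ^ 4) / w x ^ 2)
        by (apply Rdiv_le_0_compat; [exact Hk | apply pow_lt, Hwpos]).
      lra.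
Qed.
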